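(* Let $p\in[1,\infty)$, let $(W_n)$ be a sequence of real-valued random variables, and let $(a_n)$ be a deterministic sequence of nonnegative numbers such that $a_n\to0$ and $\mathcal W_p(\mathcal L(W_n),N(0,1))\le a_n$ for every $n$. Then: (a) For every $n$ and every $t>0$, $$\mathbb P(W_n\ge t)\le\Phi^c(t/2)+\frac{2^pa_n^p}{t^p},\qquad \mathbb P(|W_n|\ge t)\le2\Phi^c(t/2)+\frac{2^{p+1}a_n^p}{t^p}.$$ (b) There are constants $C_p,c_p>0$, depending only on $p$, and an integer $n_0$, depending on $(a_n)$, such that, for every $n\ge n_0$ and every $t\in\mathbb R$, $$\bigl|\mathbb P(W_n\ge t)-\Phi^c(t)\bigr|\le\frac{C_pa_n^{p/(p+1)}}{1+|t|^p}.$$ Moreover, for every $n\ge n_0$ and every $t$ with $|t|\ge1$, $$\bigl|\mathbb P(W_n\ge t)-\Phi^c(t)\bigr|\le C_p\min\Bigl\{\frac{a_n^{p/(p+1)}}{1+|t|^p},\;e^{-c_pt^2}+\frac{a_n^p}{|t|^p}\Bigr\}.$$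
   Context: $\mathcal W_p(\nu,\mu):=\inf_\gamma(\mathbb E_{(X,Y)\sim\gamma}|X-Y|^p)^{1/p}$, the infimum being over all couplings $\gamma$ of the probability measures $\nu,\mu$ on $\mathbb R$. $\mathcal L(W)$ is the law of $W$. $\Phi^c(t):=\mathbb P(Z\ge t)$ for $Z\sim N(0,1)$. *)

(* Defs.v *)
From HB Require Import structures.
From mathcomp Require Import all_boot all_order all_algebra.
From mathcomp Require Import all_classical all_reals all_analysis.

Set Implicit Arguments.
Unset Strict Implicit.
Unset Printing Implicit Defensive.

Import Order.TTheory GRing.Theory Num.Theory.
Import numFieldNormedType.Exports.

Local Open Scope classical_set_scope.
Local Open Scope ring_scope.

(* The marginal conditions are required on measurable sets only: the value of
   a measure on other sets is unspecified. *)
Definition coupling (R : realType) (nu mu : probability R R)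
    (gamma : probability (R * R)%type R) : Prop :=
  forall A : set R, measurable A ->
    gamma (fst @^-1` A) = nu A /\ gamma (snd @^-1` A) = mu A.

(* The infimum is taken in the extended reals, so that couplings with an
   infinite p-th moment contribute +oo. *)
Definition wasserstein (R : realType) (p : R) (nu mu : probability R R) :
    \bar R :=
  ereal_inf [set (poweR 'E_gamma[fun z : R * R => (`|z.1 - z.2| `^ p)%R] p^-1)%E
            | gamma in coupling nu mu].

(* [normal_prob] is a measure on [measurableTypeR R], while random variables
   take values in [R]; the two carry the same (Borel) sigma-algebra under
   different displays, and the identity map transports the measure. *)
Definition id_borel (R : realType) : measurableTypeR R -> R := idfun.

HB.instance Definition _ (R : realType) :=
  @isMeasurableFun.Build _ _ _ _ (@id_borel R)
    (@measurable_id _ (measurableTypeR R) setT).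

Definition std_normal (R : realType) : probability R R :=
  distribution (normal_prob (0 : R) 1) (@id_borel R).

Definition Phic (R : realType) (t : R) : \bar R :=
  std_normal R [set z | t <= z].

(* Main.v *)
(* Under a coupling (X, Y) of the two laws, {X >= t} is contained in
   {Y >= t - eps} together with {|X - Y| >= eps}, and Markov's inequality bounds
   the probability of the latter by (W_p / eps)^p; the reverse inclusion is
   similar.  Part (a) takes eps = t / 2.  For part (b) the shift of the Gaussian
   tail costs at most eps times the density near t, which is at most
   e * exp(- t^2 / 8) as long as eps <= max(1, |t|) / 2.  The choice
   eps = max(1, |t|) * a^(p / (p + 1)) / 2 balances the two errors and gives the
   non-uniform bound; the choice eps = |t| / 2 gives the second bound. *)
Require Import Defs.
From mathcomp Require Import all_boot all_order all_algebra.
From mathcomp Require Import all_classical all_reals all_analysis.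
From mathcomp Require Import measurable_realfun ring lra.

Set Implicit Arguments.
Unset Strict Implicit.
Unset Printing Implicit Defensive.

Import Order.TTheory GRing.Theory Num.Theory.
Import numFieldNormedType.Exports.

Local Open Scope classical_set_scope.
Local Open Scope ring_scope.


(** * Couplings and measures of sets *)

(** The left-hand side is free of [gamma], so the bound survives the infimum over couplings; on the
    right the expectation may be infinite. *)
Lemma coupling_markov (R : realType) (p eps : R) (nu mu : probability R R)
    (gamma : probability (R * R)%type R) (A B : set R) :
  0 < p -> 0 < eps -> measurable A -> measurable B ->
  (forall x y, A x -> B y \/ eps <= `|x - y|) ->
  coupling nu mu gamma ->
  ((eps `^ p)%:E * (nu A - mu B) <=
    'E_gamma[fun z : R * R => (`|z.1 - z.2| `^ p)%R])%E.
Proof.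
move=> p0 eps0 mA mB AB gnu.
pose D := [set z : R * R | (eps%:E <= `|(z.1 - z.2)%:E|)%E].
have mdiff : measurable_fun [set: (R * R)%type]
    (EFin \o (fun z : R * R => z.1 - z.2)).
  by apply/measurable_EFinP; apply: measurable_funB.
have mD : measurable D.
  rewrite -[D]setTI; apply: emeasurable_fun_c_infty => //.
  exact: measurableT_comp.
have mA1 : measurable (fst @^-1` A : set (R * R)).
  by rewrite -[X in measurable X]setTI; apply: measurable_fst.
have mB2 : measurable (snd @^-1` B : set (R * R)).
  by rewrite -[X in measurable X]setTI; apply: measurable_snd.
have nuA : (nu A <= mu B + gamma D)%E.
  rewrite -(gnu _ mA).1 -(gnu _ mB).2.
  apply: (@le_trans _ _ (gamma ((snd @^-1` B) `|` D))).
    apply: le_measure; rewrite ?inE//; first exact: measurableU.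
    by move=> [x y] /= /(AB x y)[]; [left|right; rewrite /D/= lee_fin].
  exact: measureU2.
have mar : ((eps `^ p)%:E * gamma D <=
    'E_gamma[fun z : R * R => (`|z.1 - z.2| `^ p)%R])%E.
  have E : ('E_gamma[fun z : R * R => (`|z.1 - z.2| `^ p)%R] =
      \int[gamma]_z (`|z.1 - z.2| `^ p)%:E)%E by rewrite expectation.unlock.
  (* Markov's inequality is applied with the power function extended to [\bar R], which is monotone
     on the nonnegative half-line. *)
  have mpow : measurable_fun [set: \bar R] (er_map (fun r : R => r `^ p)).
    by apply: (@measurable_er_map _ R); exact: measurable_powR.
  rewrite E -[D]setTI.
  apply: (le_integral_comp_abse gamma measurableT mpow _ _ mdiff eps0) => /=.
  - by case=> //= r _; rewrite lee_fin powR_ge0.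
  - move=> [x| |] [y| |]; rewrite !inE/= !in_itv/= ?andbT ?lee_fin ?leey//.
    by move=> x0 y0 xy; rewrite ge0_ler_powR// ?nnegrE// ltW.
apply: le_trans mar; rewrite lee_pmul2l//; last by rewrite lte_fin powR_gt0.
by rewrite leeBlDl// fin_num_measure.
Qed.

Lemma wasserstein_measure_le (R : realType) (p a eps : R)
    (nu mu : probability R R) (A B : set R) :
  0 < p -> 0 <= a -> 0 < eps -> measurable A -> measurable B ->
  (forall x y, A x -> B y \/ eps <= `|x - y|) ->
  (wasserstein p nu mu <= a%:E)%E ->
  (nu A <= mu B + (a `^ p / eps `^ p)%:E)%E.
Proof.
move=> p0 a0 eps0 mA mB AB Wa.
have ep0 : 0 < eps `^ p by rewrite powR_gt0.
rewrite -leeBlDl ?fin_num_measure//.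
rewrite -(@fineK _ (nu A)) ?fin_num_measure//.
rewrite -(@fineK _ (mu B)) ?fin_num_measure//.
rewrite -EFinB lee_fin.
set d := _ - _.
(* Only a positive excess [d] of [nu A] over [mu B] needs the distance; positivity also makes the
   root monotone and invertible. *)
have [d0|d0] := leP d 0; first by rewrite (le_trans d0)// divr_ge0 ?powR_ge0.
have ed0 : 0 <= eps `^ p * d by rewrite mulr_ge0 ?ltW.
have : (((eps `^ p * d) `^ p^-1)%:E <= a%:E)%E.
  apply: le_trans Wa; apply/ereal_infP => _ [gamma gnu <-].
  have := coupling_markov p0 eps0 mA mB AB gnu.
  rewrite -(@fineK _ (nu A)) ?fin_num_measure//.
  rewrite -(@fineK _ (mu B)) ?fin_num_measure//.
  rewrite -EFinB -EFinM -/d => le.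
  rewrite -poweR_EFin gt0_ler_poweR// ?invr_ge0 ?ltW// in_itv/= leey andbT ?lee_fin//.
  exact: le_trans le.
rewrite lee_fin => /(ge0_ler_powR (ltW p0)).
rewrite !nnegrE powR_ge0 a0 => /(_ isT isT).
by rewrite -powRrM mulVf ?gt_eqF// powRr1// ler_pdivlMr// mulrC.
Qed.

(** * Gaussian density and tail estimates *)

Lemma std_normalE (R : realType) (A : set R) :
  std_normal R A =
  (\int[lebesgue_measure]_(x in A) (normal_pdf 0 1 x)%:E)%E.
Proof. by []. Qed.

Lemma normal_pdf01_le (R : realType) (x : R) :
  normal_pdf 0 1 x <= expR (- (x ^+ 2 / 2)).
Proof.
rewrite normal_pdfE ?oner_neq0// /normal_fun subr0 expr1n mulNr.
rewrite ler_piMl ?expR_ge0// /normal_peak expr1n mul1r.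
have pi2 := pi_ge2 R.
have pi0 : 0 < pi *+ 2 :> R by lra.
rewrite invf_le1 ?sqrtr_gt0// -[leLHS]sqrtr1 ler_wsqrtr//; lra.
Qed.

Lemma Phic_itv_bnd (R : realType) (s t M : R) : s <= t ->
  (forall x, s <= x -> x <= t -> normal_pdf 0 1 x <= M) ->
  (Phic s <= Phic t + (M * (t - s))%:E)%E.
Proof.
move=> st xM.
have M0 : 0 <= M by apply: le_trans (xM s (lexx _) st); exact: normal_pdf_ge0.
have -> : Phic s = (Phic t + std_normal R `[s, t[%classic)%E.
  rewrite /Phic -measureU//.
  - congr (std_normal R _); apply/seteqP; split => x /=; rewrite in_itv/=.
      by move=> sx; case: (leP t x); [left|move=> ?; right; rewrite sx].
    by case=> [|/andP[]//]; exact: le_trans st.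
  - by rewrite -set_itvcy; exact: measurable_itv.
  - apply/seteqP; split => x //= [tx]; rewrite in_itv/= => /andP[_].
    by rewrite ltNge tx.
rewrite leeD2l// std_normalE.
apply: (@le_trans _ _ (\int[lebesgue_measure]_(x in `[s, t[%classic) M%:E)%E).
  apply: ge0_le_integral => //=.
  - by move=> x _; rewrite lee_fin normal_pdf_ge0.
  - apply/measurable_EFinP/measurable_funTS; exact: measurable_normal_pdf.
  - by move=> x /=; rewrite in_itv/= lee_fin => /andP[sx /ltW xt]; exact: xM.
rewrite integral_cst//= lebesgue_measure_itv/= lte_fin.
case: ltP => _; first by rewrite -EFinB -EFinM.
by rewrite mule0 lee_fin mulr_ge0// subr_ge0.
Qed.

(** The density is even, so the substitution [x] to [- x] exchanges the two tails. *)
Lemma std_normal_lower_tail (R : realType) (t : R) :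
  std_normal R [set z | z <= - t] = Phic t.
Proof.
rewrite /Phic !std_normalE -set_itvNyc -set_itvcy.
rewrite ge0_integration_by_substitutionNy.
- apply: eq_integral => x _ /=.
  by rewrite !normal_pdfE ?oner_neq0// /normal_fun !subr0 sqrrN.
- apply: continuous_subspaceT => x.
  by apply: continuous_normal_pdf; exact: oner_neq0.
- by move=> x _; exact: normal_pdf_ge0.
Qed.

(** If [|t|] is at least 1, then [|x|] is at least [|t| / 2] and the exponent is immediate. For
    smaller [|t|] the factor [expR 1] compensates [expR (- (t ^+ 2 / 8))], as the density is at most
    1. *)
Lemma normal_pdf_near_bnd (R : realType) (t x : R) :
  `|x - t| <= Num.max 1 `|t| / 2 ->
  normal_pdf 0 1 x <= expR 1 * expR (- (t ^+ 2 / 8)).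
Proof.
move=> xt; apply: le_trans (normal_pdf01_le _) _.
rewrite -expRD ler_expR.
have tx : `|t| <= `|x| + Num.max 1 `|t| / 2.
  by rewrite -lerBlDl (le_trans _ xt)// distrC; exact: lerB_dist.
rewrite -(real_normK (num_real t)) -(real_normK (num_real x)).
have := normr_ge0 t; have := normr_ge0 x; move: tx.
by rewrite maxEle; case: ifP => ?; nra.
Qed.

(** This lets Gaussian decay absorb any power of [max(1, |t|)]. The exponential is written as an
    [s]-th power, so that only the linear bound of [expR] from below by [1 + x] is used, at
    [x = t ^+ 2 / (8 * s)]. *)
Lemma max_powR_expR (R : realType) (s t : R) : 1 <= s ->
  Num.max 1 `|t| `^ s <= (8 * s) `^ s * expR (t ^+ 2 / 8).
Proof.
move=> s1; have s0 : 0 < s by lra.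
have -> : t ^+ 2 / 8 = t ^+ 2 / (8 * s) * s by field; rewrite gt_eqF.
rewrite expRM -powRM ?expR_ge0//; last lra.
apply: ge0_ler_powR; rewrite ?nnegrE; first lra.
- by rewrite le_max ler01.
- by rewrite mulr_ge0 ?expR_ge0//; lra.
apply: (@le_trans _ _ (8 * s * (1 + t ^+ 2 / (8 * s)))); last first.
  by rewrite ler_wpM2l ?expR_ge1Dx//; lra.
have -> : 8 * s * (1 + t ^+ 2 / (8 * s)) = 8 * s + t ^+ 2.
  by field; rewrite gt_eqF.
rewrite ge_max -(real_normK (num_real t)).
by apply/andP; split; nra.
Qed.

(* The two marginals are exchanged by passing to complements. *)
Lemma wasserstein_measure_ge (R : realType) (p a eps : R)
    (nu mu : probability R R) (A B : set R) :
  0 < p -> 0 <= a -> 0 < eps -> measurable A -> measurable B ->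
  (forall x y, B y -> A x \/ eps <= `|x - y|) ->
  (wasserstein p nu mu <= a%:E)%E ->
  (mu B <= nu A + (a `^ p / eps `^ p)%:E)%E.
Proof.
move=> p0 a0 eps0 mA mB BA Wa.
have : (nu (~` A) <= mu (~` B) + (a `^ p / eps `^ p)%:E)%E.
  apply: wasserstein_measure_le => //; [exact: measurableC|exact: measurableC|].
  by move=> x y nAx; have [/BA-/(_ x)[//|]|nBy] := pselect (B y); [right|left].
rewrite !probability_setC//.
rewrite -(@fineK _ (nu A)) ?fin_num_measure//.
rewrite -(@fineK _ (mu B)) ?fin_num_measure//.
by rewrite -!EFinB -!EFinD !lee_fin => h; lra.
Qed.

Lemma measurable_ge (R : realType) (t : R) : measurable [set x : R | t <= x].
Proof. by rewrite -set_itvcy; exact: measurable_itv. Qed.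

Lemma measurable_norm_ge (R : realType) (t : R) :
  measurable [set x : R | t <= `|x|].
Proof.
rewrite (_ : [set _ | _] = setT `&` (fun x : R => `|x|) @^-1` [set x | t <= x]).
  by apply: normr_measurable => //; exact: measurable_ge.
by rewrite setTI.
Qed.

(** * Difference between a tail and the Gaussian tail *)

(** Common source of both bounds of part (b), with [eps] left free: the first term is the coupling
    error, the second the cost of shifting the Gaussian tail by [eps] in either direction. *)
Lemma tail_diff_le (R : realType) (p a eps t : R) (nu : probability R R) :
  0 < p -> 0 <= a -> 0 < eps -> eps <= Num.max 1 `|t| / 2 ->
  (wasserstein p nu (std_normal R) <= a%:E)%E ->
  `|fine (nu [set x | t <= x]) - fine (Phic t)| <=
    a `^ p / eps `^ p + eps * (expR 1 * expR (- (t ^+ 2 / 8))).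
Proof.
move=> p0 a0 eps0 epsM Wa.
set M := expR 1 * _; set r := a `^ p / _.
have up : (nu [set x | (t <= x)%R] <= Phic (t - eps) + r%:E)%E.
  apply: wasserstein_measure_le Wa => //; try exact: measurable_ge.
  move=> x y /= tx; case: (leP (t - eps) y) => [|yt]; [by left|right].
  by rewrite ger0_norm; lra.
have lo : (Phic (t + eps) <= nu [set x | (t <= x)%R] + r%:E)%E.
  apply: wasserstein_measure_ge Wa => //; try exact: measurable_ge.
  move=> x y /= ty; case: (leP t x) => [|xt]; [by left|right].
  by rewrite distrC ger0_norm; lra.
have upN : (Phic (t - eps) <= Phic t + (M * (t - (t - eps)))%:E)%E.
  apply: Phic_itv_bnd; first lra.
  move=> x x1 x2; apply: normal_pdf_near_bnd; apply: le_trans epsM.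
  by rewrite ler_norml; apply/andP; split; lra.
have loN : (Phic t <= Phic (t + eps) + (M * (t + eps - t))%:E)%E.
  apply: Phic_itv_bnd; first lra.
  move=> x x1 x2; apply: normal_pdf_near_bnd; apply: le_trans epsM.
  by rewrite ler_norml; apply/andP; split; lra.
have Pf (u : R) : Phic u = (fine (Phic u))%:E.
  by rewrite fineK// fin_num_measure//; exact: measurable_ge.
have nf : nu [set x | t <= x] = (fine (nu [set x | t <= x]))%:E.
  by rewrite fineK// fin_num_measure//; exact: measurable_ge.
move: up lo upN loN; rewrite nf (Pf t) (Pf (t - eps)) (Pf (t + eps)) -!EFinD !lee_fin.
move=> up lo upN loN.
by rewrite ler_norml; apply/andP; split; lra.
Qed.

(* The scale [b] stands for [a `^ (p / (p + 1))], but stays positive when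
   [a = 0]; [eps = max(1, |t|) * b / 2]. *)
Lemma tail_diff_le_scale (R : realType) (p a b t : R) (nu : probability R R) :
  1 <= p -> 0 <= a -> 0 < b <= 1 -> a `^ p <= b `^ (p + 1) ->
  (wasserstein p nu (std_normal R) <= a%:E)%E ->
  `|fine (nu [set x | t <= x]) - fine (Phic t)| <=
    (2 * 2 `^ p + expR 1 * (8 * (p + 1)) `^ (p + 1)) * b / (1 + `|t| `^ p).
Proof.
move=> p1 a0 /andP[b0 b1] ab Wa; have p0 : 0 < p by lra.
set M := Num.max 1 `|t|; set K := (8 * _) `^ _.
have M1 : 1 <= M by rewrite /M le_max lexx.
have M0 : 0 < M by lra.
have eps0 : 0 < M * b / 2 by rewrite divr_gt0// mulr_gt0.
have epsM : M * b / 2 <= M / 2 by nra.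
apply: le_trans (tail_diff_le p0 a0 eps0 epsM Wa) _.
have Mp0 : 0 < M `^ p by rewrite powR_gt0.
have tp0 : 0 <= `|t| `^ p by exact: powR_ge0.
have tM : 1 + `|t| `^ p <= 2 * M `^ p.
  have : 1 `^ p <= M `^ p by rewrite ge0_ler_powR ?nnegrE ?(ltW p0) ?(ltW M0) ?ler01.
  have : `|t| `^ p <= M `^ p.
    by rewrite ge0_ler_powR ?nnegrE ?(ltW p0) ?(ltW M0)// /M le_max lexx orbT.
  by rewrite powR1; lra.
(* The passage from [M] to the weight [1 + |t|^p] costs a factor 2. *)
have inv : (M `^ p)^-1 <= 2 / (1 + `|t| `^ p).
  by rewrite ler_pdivlMr ?ltr_pwDl// mulrC ler_pdivrMr// mulrC.
have -> : (2 * 2 `^ p + expR 1 * K) * b / (1 + `|t| `^ p) =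
   2 `^ p * b * (2 / (1 + `|t| `^ p)) +
   expR 1 * K * b / 2 * (2 / (1 + `|t| `^ p)) by field; rewrite gt_eqF// ltr_pwDl.
apply: lerD.
  (* Coupling error: after cancelling [M]^ p[and the factor]2 [^ p] coming from [eps], what remains
     is the hypothesis on [a] and [b]. *)
  apply: le_trans (_ : 2 `^ p * b * (M `^ p)^-1 <= _); last first.
    by rewrite ler_wpM2l// mulr_ge0 ?powR_ge0// ltW.
  rewrite ler_pdivrMr ?powR_gt0//.
  have : (2 * (M * b / 2)) `^ p = M `^ p * b `^ p.
    by rewrite -powRM ?(ltW M0) ?(ltW b0)//; congr (_ `^ _); field.
  rewrite powRM ?(ltW eps0)// => e.
  have -> : 2 `^ p * b * (M `^ p)^-1 * (M * b / 2) `^ p =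
      2 `^ p * (M * b / 2) `^ p * b / M `^ p by field; rewrite gt_eqF.
  rewrite e.
  have -> : M `^ p * b `^ p * b / M `^ p = b `^ p * b by field; rewrite gt_eqF.
  by rewrite -[X in _ * X](powRr1 (ltW b0)) -powRD ?(gt_eqF b0) ?implybT.
have key : M * expR (- (t ^+ 2 / 8)) <= K / M `^ p.
  rewrite ler_pdivlMr// expRN mulrAC ler_pdivrMr ?expR_gt0//.
  rewrite -[X in X * _](powRr1 (ltW M0)) -powRD ?(gt_eqF M0) ?implybT// addrC.
  by apply: max_powR_expR; lra.
have -> : M * b / 2 * (expR 1 * expR (- (t ^+ 2 / 8))) =
  expR 1 * b / 2 * (M * expR (- (t ^+ 2 / 8))) by ring.
have -> : expR 1 * K * b / 2 * (2 / (1 + `|t| `^ p)) =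
  expR 1 * b / 2 * (K * (2 / (1 + `|t| `^ p))) by field; rewrite gt_eqF// ltr_pwDl.
rewrite ler_wpM2l ?divr_ge0 ?mulr_ge0 ?expR_ge0 ?(ltW b0)//.
by apply: le_trans key _; rewrite ler_wpM2l ?powR_ge0.
Qed.

Lemma tail_diff_le_nonuniform (R : realType) (p a t : R) (nu : probability R R) :
  1 <= p -> 0 <= a <= 1 ->
  (wasserstein p nu (std_normal R) <= a%:E)%E ->
  `|fine (nu [set x | t <= x]) - fine (Phic t)| <=
    (2 * 2 `^ p + expR 1 * (8 * (p + 1)) `^ (p + 1)) * a `^ (p / (p + 1)) /
      (1 + `|t| `^ p).
Proof.
move=> p1 /andP[a0 a1] Wa.
have p0 : 0 < p by lra.
have q0 : 0 < p / (p + 1) by rewrite divr_gt0//; lra.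
have tp0 : 0 < 1 + `|t| `^ p by rewrite ltr_pwDl ?powR_ge0.
set C := 2 * _ + _; set al := a `^ (p / _).
have C0 : 0 < C.
  by rewrite ltr_pwDl ?mulr_ge0 ?expR_ge0 ?powR_ge0// mulr_gt0 ?powR_gt0.
have alE : a `^ p = al `^ (p + 1).
  by rewrite -powRrM divfK// gt_eqF//; lra.
have al0 : 0 <= al by exact: powR_ge0.
have al1 : al <= 1.
  have := @ge0_ler_powR _ _ (ltW q0) a 1; rewrite powR1; apply => //.
  by rewrite nnegrE ler01.
rewrite ler_pdivlMr// mulrC -ler_pdivrMl//.
apply/ler_addgt0Pr => e e0.
have : al < al + e by lra.
move: (al + e) => z alz.
have bnd b : al <= b -> 0 < b <= 1 ->
    C^-1 * ((1 + `|t| `^ p) * `|fine (nu [set x | t <= x]) - fine (Phic t)|) <= b.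
  move=> alb b01; rewrite ler_pdivrMl// mulrC -ler_pdivlMr//.
  apply: tail_diff_le_scale Wa => //.
  have [b0 _] := andP b01.
  by rewrite alE ge0_ler_powR ?nnegrE ?(ltW b0)//; lra.
(* Scales are limited to 1; when [z] exceeds 1, the scale 1 serves, since [al] is at most 1. *)
have [z1|z1] := leP z 1; first by apply: bnd; [exact: ltW|apply/andP; split; lra].
by apply: le_trans (ltW z1); apply: bnd => //; rewrite ltr01 lexx.
Qed.

(** Half of the exponent [t ^+ 2 / 8] is spent on absorbing the factor [|t|] of the shift; the other
    half gives the rate [16^-1]. *)
Lemma tail_diff_le_gauss (R : realType) (p a t : R) (nu : probability R R) :
  1 <= p -> 0 <= a -> 1 <= `|t| ->
  (wasserstein p nu (std_normal R) <= a%:E)%E ->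
  `|fine (nu [set x | t <= x]) - fine (Phic t)| <=
    8 * expR 1 * expR (- 16^-1 * t ^+ 2) + 2 `^ p * (a `^ p / `|t| `^ p).
Proof.
move=> p1 a0 t1 Wa; have p0 : 0 < p by lra.
have t20 : 0 < `|t| / 2 by lra.
have t2M : `|t| / 2 <= Num.max 1 `|t| / 2 by rewrite ler_pM2r// le_max lexx orbT.
apply: le_trans (tail_diff_le p0 a0 t20 t2M Wa) _.
rewrite addrC lerD//; last first.
  have e : `|t| `^ p = 2 `^ p * (`|t| / 2) `^ p.
    by rewrite -powRM ?(ltW t20)//; congr (_ `^ _); field.
  have ? : 0 < (`|t| / 2) `^ p by rewrite powR_gt0.
  have ? : 0 < 2 `^ p :> R by rewrite powR_gt0.
  by rewrite e le_eqVlt; apply/orP; left; apply/eqP; field; rewrite !gt_eqF.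
have te : `|t| <= 16 * expR (t ^+ 2 / 16).
  have := expR_ge1Dx (t ^+ 2 / 16).
  by rewrite -(real_normK (num_real t)); nra.
have -> : - (t ^+ 2 / 8) = - (t ^+ 2 / 16) + - 16^-1 * t ^+ 2 by field.
rewrite expRD expRN.
have E0 := expR_gt0 (t ^+ 2 / 16).
have : `|t| / expR (t ^+ 2 / 16) <= 16 by rewrite ler_pdivrMr.
set u := expR (t ^+ 2 / 16) in te E0 *; set v := expR (_ * _) => h.
have -> : `|t| / 2 * (expR 1 * (u^-1 * v)) = `|t| / u * (expR 1 * v / 2).
  by field; rewrite gt_eqF.
have -> : 8 * expR 1 * v = 16 * (expR 1 * v / 2) by field.
by rewrite ler_wpM2r// divr_ge0// mulr_ge0 ?expR_ge0.
Qed.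

(** * Two-sided tails and the final assembly *)

Lemma std_normal_abs_tail (R : realType) (t : R) :
  (std_normal R [set z | (t <= `|z|)%R] <= 2%:E * Phic t)%E.
Proof.
have mle : measurable [set z : R | z <= - t].
  by rewrite -set_itvNyc; exact: measurable_itv.
have mge := measurable_ge t.
apply: (@le_trans _ _ (std_normal R
    ([set z | (t <= z)%R] `|` [set z | (z <= - t)%R]))).
  apply: le_measure; rewrite ?inE//.
  - exact: measurable_norm_ge.
  - exact: measurableU.
  - by move=> z /=; rewrite ler_normr => /orP[tz|tz]; [left|right; rewrite lerNr].
apply: le_trans (measureU2 _ mge mle) _.
by rewrite mule_natl mule2n leeD// -std_normal_lower_tail.
Qed.

Theorem theorem2p10 (R : realType) (p : R) (hp : 1 <= p) :
  (forall (a : nat -> R) (d : nat -> measure_display)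
      (T : forall n : nat, measurableType (d n))
      (P : forall n : nat, probability (T n) R)
      (W : forall n : nat, {RV (P n) >-> R}),
    (forall n : nat, 0 <= a n) ->
    a n @[n --> \oo] --> (0 : R) ->
    (forall n : nat,
      (wasserstein p (distribution (P n) (W n)) (std_normal R) <=
        (a n)%:E)%E) ->
    forall (n : nat) (t : R), 0 < t ->
      (P n [set w | (t <= W n w)%R] <=
        Phic (t / 2) + (2 `^ p * a n `^ p / t `^ p)%:E)%E /\
      (P n [set w | (t <= `|W n w|)%R] <=
        2%:E * Phic (t / 2) + (2 `^ (p + 1) * a n `^ p / t `^ p)%:E)%E) /\
  (exists C c : R, 0 < C /\ 0 < c /\
    forall a : nat -> R,
      (forall n : nat, 0 <= a n) ->
      a n @[n --> \oo] --> (0 : R) ->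
      exists n0 : nat,
        forall (d : nat -> measure_display)
          (T : forall n : nat, measurableType (d n))
          (P : forall n : nat, probability (T n) R)
          (W : forall n : nat, {RV (P n) >-> R}),
          (forall n : nat,
            (wasserstein p (distribution (P n) (W n)) (std_normal R) <=
              (a n)%:E)%E) ->
          forall n : nat, (n0 <= n)%N ->
            (forall t : R,
              (`|P n [set w | (t <= W n w)%R] - Phic t| <=
                (C * a n `^ (p / (p + 1)) / (1 + `|t| `^ p))%:E)%E) /\
            (forall t : R, 1 <= `|t| ->
              (`|P n [set w | (t <= W n w)%R] - Phic t| <=
                (C * Num.min (a n `^ (p / (p + 1)) / (1 + `|t| `^ p))
                       (expR (- c * t ^+ 2) + a n `^ p / `|t| `^ p))%:E)%E)).
Proof.
have p0 : 0 < p by lra.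
split.
  move=> a d T P W a0 _ Wa n t t0.
  have t20 : 0 < t / 2 by lra.
  have e : 2 `^ p * a n `^ p / t `^ p = a n `^ p / (t / 2) `^ p.
    have -> : t `^ p = 2 `^ p * (t / 2) `^ p.
      by rewrite -powRM ?(ltW t20)//; congr (_ `^ _); field.
    by field; rewrite !gt_eqF// powR_gt0.
  split.
    rewrite e -[P n _]/(distribution (P n) (W n) [set x : R | t <= x]).
    apply: wasserstein_measure_le (Wa n) => //; try exact: measurable_ge.
    move=> x y /= tx; case: (leP (t / 2) y) => [|yt]; [by left|right].
    by rewrite ger0_norm; lra.
  (* The event for [|W n|] is compared in one go, through the reverse triangle inequality, with
     error constant [2]^ p[; this is below the stated]2 [^ (p + 1)]. *)
  apply: (@le_trans _ _ (std_normal R [set z | (t / 2 <= `|z|)%R] +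
      (2 `^ p * a n `^ p / t `^ p)%:E)%E).
    rewrite e -[P n _]/(distribution (P n) (W n) [set x : R | t <= `|x|]).
    apply: wasserstein_measure_le (Wa n) => //; try exact: measurable_norm_ge.
    move=> x y /= tx; case: (leP (t / 2) `|y|) => [|yt]; [by left|right].
    by apply: le_trans (lerB_dist x y); lra.
  apply: leeD; first exact: std_normal_abs_tail.
  rewrite lee_fin -!mulrA ler_wpM2r ?divr_ge0 ?powR_ge0//.
  by rewrite ler_powR//; lra.
pose C1 : R := 2 * 2 `^ p + expR 1 * (8 * (p + 1)) `^ (p + 1).
have P0 : 0 < 2 `^ p :> R by rewrite powR_gt0.
have e0 := expR_gt0 (1 : R).
have C10 : 0 < C1.
  by rewrite /C1 ltr_pwDl ?mulr_ge0 ?expR_ge0 ?powR_ge0// mulr_gt0.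
(* The sum dominates the constant of the non-uniform bound and both constants of the Gaussian
   bound. *)
exists (C1 + 2 `^ p + 8 * expR 1), 16^-1.
split; first lra.
split; first by rewrite invr_gt0.
move=> a a0 acv.
(* The threshold depends on [a] alone: it secures [a n <= 1], which the non-uniform bound
   requires. *)
have [n0 _ an1] : \forall n \near \oo, a n <= 1.
  by apply: (cvgr_le _ acv); exact: ltr01.
exists n0 => d T P W Wa n n0n.
pose nu : probability R R := distribution (P n) (W n).
have diffE t : `|P n [set w | (t <= W n w)%R] - Phic t|%E =
    (`|fine (nu [set x | t <= x]) - fine (Phic t)|)%:E.
  rewrite -[P n _]/(nu [set x | t <= x]).
  rewrite -[in LHS](@fineK _ (nu _)) ?fin_num_measure//; last exact: measurable_ge.
  by rewrite -[in LHS](@fineK _ (Phic t)) ?fin_num_measure//; exact: measurable_ge.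
have a01 : 0 <= a n <= 1 by rewrite a0 (an1 n n0n).
have bnd1 t : `|fine (nu [set x | t <= x]) - fine (Phic t)| <=
    (C1 + 2 `^ p + 8 * expR 1) * (a n `^ (p / (p + 1)) / (1 + `|t| `^ p)).
  apply: le_trans (tail_diff_le_nonuniform t hp a01 (Wa n)) _.
  rewrite -mulrA ler_wpM2r ?divr_ge0 ?powR_ge0 ?addr_ge0 ?powR_ge0//.
  by rewrite -/C1; lra.
split=> t; first by rewrite diffE lee_fin -mulrA.
move=> t1; rewrite diffE lee_fin minEle; case: ifP => // _.
apply: le_trans (tail_diff_le_gauss hp (a0 n) t1 (Wa n)) _.
rewrite mulrDr; apply: lerD; rewrite ler_wpM2r ?expR_ge0 ?divr_ge0 ?powR_ge0//; lra.
Qed.
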